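(* There is an absolute constant $C>0$ such that for all positive integers $n\le m$ (with $m$ sufficiently large), \[ s(m,n,3)\le C\sqrt{mn\lg\frac{2m}{n}}. \]
   Context: $\lg$ denotes logarithm to base $2$. Let $[m]=\{1,\dots,m\}$. An $(m,n,s)$-storing scheme is a map $\phi$ from the family of subsets of $[m]$ of size at most $n$ to $\{0,1\}^s$. An $(m,s,t)$-query scheme is a family $\{T_u\}_{u\in[m]}$ of Boolean decision trees of depth at most $t$: each internal node is marked with an index in $\{1,\dots,s\}$, has outgoing edges labelled $0$ and $1$, and each leaf is marked Yes or No; $T_u$ maps $\{0,1\}^s$ to $\{\mathrm{Yes},\mathrm{No}\}$ by following the edges given by the probed bits (probes may be adaptive). An $(m,n,s,t)$-scheme is a pair $(\phi,\{T_u\})$ such that for every $S\subseteq[m]$ with $|S|\le n$ and every $u\in[m]$, $T_u(\phi(S))=\mathrm{Yes}$ iff $u\in S$. $s(m,n,t)$ is the minimum $s$ for which an $(m,n,s,t)$-scheme exists. *)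

(* Defs.v *)
From mathcomp Require Import all_boot all_order all_algebra.
From mathcomp Require Import all_classical all_reals all_analysis.

Set Implicit Arguments.
Unset Strict Implicit.
Unset Printing Implicit Defensive.

Import Order.TTheory GRing.Theory Num.Theory.

Definition lg (R : realType) (x : R) : R := (ln x / ln 2)%R.

(* The universe [m] is 'I_m and bit positions {1..s} are 'I_s. *)
Definition small_set (m n : nat) : Type := {S : {set 'I_m} | #|S| <= n}.

Definition storing_scheme (m n s : nat) : Type :=
  small_set m n -> s.-tuple bool.

(* In [Node i l r], [l] is reached along the edge labelled 0 (bit [i] is
   [false]) and [r] along the edge labelled 1; a leaf [true] means Yes. *)
Inductive dtree (s : nat) : Type :=
| Leaf of bool
| Node of 'I_s & dtree s & dtree s.

Fixpoint depth (s : nat) (T : dtree s) : nat :=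
  if T is Node _ l r then (maxn (depth l) (depth r)).+1 else 0.

Fixpoint eval (s : nat) (T : dtree s) (x : s.-tuple bool) : bool :=
  match T with
  | Leaf b => b
  | Node i l r => if tnth x i then eval r x else eval l x
  end.

Record query_scheme (m s t : nat) : Type := QueryScheme {
  query_tree :> 'I_m -> dtree s;
  query_depth : forall u, depth (query_tree u) <= t }.

Definition is_scheme (m n s t : nat)
    (phi : storing_scheme m n s) (T : query_scheme m s t) : Prop :=
  forall (S : small_set m n) (u : 'I_m), eval (T u) (phi S) = (u \in sval S).

Definition has_scheme (m n s t : nat) : Prop :=
  exists (phi : storing_scheme m n s) (T : query_scheme m s t), is_scheme phi T.

(* [min_space m n t s] says s(m,n,t) = s. The minimum is a relation rather than
   a function because no scheme need exist when t = 0. *)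
Definition min_space (m n t s : nat) : Prop :=
  has_scheme m n s t /\ forall s', has_scheme m n s' t -> s <= s'.

(* Main.v *)
Require Import Defs.
From mathcomp Require Import all_boot all_order all_algebra.
From mathcomp Require Import all_classical all_reals all_analysis.
From mathcomp Require Import zify ring lra.
(* Reimported because [all_classical] shadows the names of the lemmas on finite sets. *)
From mathcomp Require Import fintype finset.

Import Order.TTheory GRing.Theory Num.Theory.

Set Implicit Arguments.
Unset Strict Implicit.
Unset Printing Implicit Defensive.

(** Hash every element [u] to two cells of a selector table and, for each of the
    four outcomes [j] of probing them, to a cell of an answer table; all tables
    have size [s]. Given [S], at most [4n] answer cells are hit by [S]. If every
    pair [(u, j)] lying on such a cell can be matched injectively either to one
    of the selector cells of [u] (whose bit is then set so that outcome [j]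
    cannot occur at [u]) or to its answer cell, then each of these answer cells
    is read by at most one element and can store its membership. By Hall's
    theorem the matching exists as soon as, for all sets [X] of selector cells
    and [Z] of at most [4n] answer cells, at most [|X| + |Z|] pairs have all
    their cells in [X] and [Z]. A random hash function has this property with
    positive probability once [s^2 >= K m n] for a suitable constant [K], by
    Markov's inequality for an exponential moment and a union bound over [X] and
    [Z]. This even gives [s(m,n,3) = O(sqrt (m n))]. *)

(** * Hall's marriage theorem *)

Section Hall.

Variables (I J : finType) (D : {set I}).

Definition hall_condition (A : I -> {set J}) :=
  [forall F : {set I}, (F \subset D) ==> (#|F| <= #|\bigcup_(i in F) A i|)].

Lemma hall_conditionP A :
  reflect (forall F : {set I}, F \subset D -> #|F| <= #|\bigcup_(i in F) A i|)
          (hall_condition A).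
Proof. by apply: (iffP forallP) => H F; apply/implyP; apply: H. Qed.

Definition drop_point (A : I -> {set J}) i x k :=
  if k == i then A i :\ x else A k.

(** Only the set at [i] shrinks, so a family that breaks the condition after the drop must contain
    [i]. *)
Lemma hall_violator A i x : hall_condition A -> ~~ hall_condition (drop_point A i x) ->
  exists F : {set I}, [/\ F \subset D, i \in F &
    #|(\bigcup_(k in F :\ i) A k) :|: (A i :\ x)| < #|F|].
Proof.
move=> /hall_conditionP hA; rewrite negb_forall => /existsP[F].
rewrite negb_imply -ltnNge => /andP[FD ltF].
have iF : i \in F.
  apply/negPn/negP => iF; move: ltF; rewrite ltnNge => /negP; apply.
  rewrite (eq_bigr A) ?hA// => k kF; rewrite /drop_point.
  by case: eqP kF => // ->; rewrite (negPf iF).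
exists F; split=> //; apply: leq_ltn_trans ltF; apply: subset_leq_card.
apply/subsetP => j; rewrite 2!inE => /orP[/bigcupP[k]|jA].
  rewrite !inE => /andP[ki kF] jA; apply/bigcupP; exists k => //.
  by rewrite /drop_point (negPf ki).
by apply/bigcupP; exists i => //; rewrite /drop_point eqxx /= !inE in jA *.
Qed.

(* Rado's argument: if [x] and [y] could both not be dropped from [A i],
   submodularity of the cardinality of unions would break Hall's condition. *)
Lemma hall_drop A i x y : i \in D -> x != y ->
  hall_condition A ->
  hall_condition (drop_point A i x) || hall_condition (drop_point A i y).
Proof.
move=> iD xy hA; apply/negPn/negP; rewrite negb_or => /andP[].
move=> /(hall_violator hA)[F1 [F1D iF1 lt1]] /(hall_violator hA)[F2 [F2D iF2 lt2]].
set P := (_ :|: _) in lt1; set Q := (_ :|: _) in lt2.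
have /hall_conditionP hA' := hA.
have PQU : #|F1 :|: F2| <= #|P :|: Q|.
  apply: leq_trans (hA' _ _) (subset_leq_card _); first by rewrite subUset F1D.
  apply/bigcupsP => k; rewrite inE => kF; apply/subsetP => j jA.
  rewrite !inE; have [ki|ki] := eqVneq k i.
    rewrite ki in jA; rewrite jA !andbT.
    by have [->|jx] := eqVneq j x; rewrite ?xy ?orbT.
  case/orP: kF => kF; [apply/orP; left|apply/orP; right]; apply/orP; left;
    by apply/bigcupP; exists k => //; rewrite !inE ki.
have PQI : #|(F1 :&: F2) :\ i| <= #|P :&: Q|.
  apply: leq_trans (hA' _ _) (subset_leq_card _).
    by apply/subsetP => k; rewrite !inE => /and3P[_ /(subsetP F1D)].
  apply/bigcupsP => k; rewrite !inE => /and3P[ki k1 k2]; apply/subsetP => j jA.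
  by rewrite !inE; apply/andP; split; apply/orP; left; apply/bigcupP;
    exists k => //; rewrite !inE ki.
(* Submodularity: [#|P| + #|Q|] is at least [#|F1 :|: F2| + #|F1 :&: F2| - 1 = #|F1| + #|F2| - 1],
   while [lt1] and [lt2] bound it by [#|F1| + #|F2| - 2]. *)
have := cardsD1 i (F1 :&: F2); rewrite inE iF1 iF2 /=.
have := cardsUI P Q; have := cardsUI F1 F2; lia.
Qed.

(** Induction on the total size: [hall_drop] shrinks any set with two points until all are
    singletons, and Hall's condition on pairs of indices then makes these distinct. [j0] is a
    default value where [A i] is empty, outside [D]. *)
Lemma hall_marriage (A : I -> {set J}) (j0 : J) : hall_condition A ->
  exists f : I -> J, {in D, forall i, f i \in A i} /\ {in D &, injective f}.
Proof.
have [n] := ubnP (\sum_(i in D) #|A i|); elim: n A => // n IH A ltn hA.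
have /hall_conditionP hA' := hA.
have [/existsP[i /andP[iD]]|] := boolP [exists i, (i \in D) && (1 < #|A i|)].
  move=> /card_gt1P[x [y [xA yA xy]]].
  have IHx z : z \in A i -> hall_condition (drop_point A i z) ->
      exists f : I -> J, {in D, forall i, f i \in A i} /\ {in D &, injective f}.
    move=> zA /IH[|f [fA finj]].
      rewrite -ltnS; apply: leq_trans _ ltn; rewrite ltnS.
      rewrite (bigD1 i)//= [X in _ < X](bigD1 i)//=.
      rewrite /drop_point eqxx (cardsD1 z (A i)) zA add1n addSn ltnS.
      rewrite leq_add2l (eq_bigr (fun k => #|A k|))// => k /andP[_ /negPf ki].
      by rewrite ki.
    exists f; split=> // k /fA; rewrite /drop_point.
    by case: eqP => // ->; rewrite inE => /andP[].
  by case/orP: (hall_drop iD xy hA); apply: IHx.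
rewrite negb_exists => /forallP A1.
have Ai i : i \in D -> exists x, A i = [set x].
  move=> iD; apply/cards1P.
  have := hA' [set i]; rewrite sub1set big_set1 cards1 => /(_ iD).
  by have := A1 i; rewrite iD /= -leqNgt eqn_leq => -> ->.
exists (fun i => odflt j0 [pick x in A i]); split=> [i iD|i k iD kD].
  by case: pickP => [//|] /=; have [x ->] := Ai i iD => /(_ x); rewrite inE eqxx.
have [x Ax] := Ai i iD; have [y Ay] := Ai k kD.
case: pickP => [x'|/(_ x)]; last by rewrite Ax inE eqxx.
rewrite Ax inE => /eqP ->.
case: pickP => [y'|/(_ y)]; last by rewrite Ay inE eqxx.
rewrite Ay inE => /eqP -> /= xy; apply/eqP/negPn/negP => ik.
have := hA' [set i; k]; rewrite subUset !sub1set iD kD cards2 ik => /(_ isT).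
by rewrite bigcup_setU !big_set1 Ax Ay xy setUid cards1.
Qed.

End Hall.

(** * From a sparse hash function to a scheme *)

(* An element is hashed to two cells of a selector table and, for each pair of
   selector bits, to a cell of an answer table. *)
Definition code s : Type := ('I_s * 'I_s * {ffun bool * bool -> 'I_s})%type.

Definition selector1 s (w : code s) : 'I_s := w.1.1.
Definition selector2 s (w : code s) : 'I_s := w.1.2.
Definition answer s (w : code s) : {ffun bool * bool -> 'I_s} := w.2.

Section Scheme.

Variables (m s : nat) (h : 'I_m -> code s).

Definition captured (X Z : {set 'I_s}) : {set 'I_m * (bool * bool)} :=
  [set p | [&& selector1 (h p.1) \in X, selector2 (h p.1) \in X
             & answer (h p.1) p.2 \in Z]].

Definition sparse n := forall X Z : {set 'I_s},
  #|Z| <= n * 4 -> #|captured X Z| <= #|X| + #|Z|.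

Definition answer_node (z : 'I_s) : dtree (s + s) :=
  Node (rshift s z) (Leaf _ false) (Leaf _ true).

Definition hash_tree u : dtree (s + s) :=
  let node2 b := Node (lshift s (selector2 (h u)))
    (answer_node (answer (h u) (b, false))) (answer_node (answer (h u) (b, true))) in
  Node (lshift s (selector1 (h u))) (node2 false) (node2 true).

Definition memory (W C : 'I_s -> bool) : (s + s).-tuple bool :=
  [tuple match split i with inl x => W x | inr z => C z end | i < s + s].

Lemma eval_hash_tree W C u : Defs.eval (hash_tree u) (memory W C) =
  C (answer (h u) (W (selector1 (h u)), W (selector2 (h u)))).
Proof.
have lE x : tnth (memory W C) (lshift s x) = W x.
  by rewrite tnth_mktuple (unsplitK (inl x)).
have rE z : tnth (memory W C) (rshift s z) = C z.
  by rewrite tnth_mktuple (unsplitK (inr z)).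
rewrite /= !lE; case: (W (selector1 _)); case: (W (selector2 _));
  by rewrite /= rE; case: (C _).
Qed.

Variable S : {set 'I_m}.

Definition hit_cells : {set 'I_s} :=
  [set answer (h p.1) p.2 | p in finset.setX S [set: bool * bool]].

Definition active : {set 'I_m * (bool * bool)} :=
  [set p | answer (h p.1) p.2 \in hit_cells].

Lemma card_hit_cells : #|hit_cells| <= #|S| * 4.
Proof.
apply: leq_trans (leq_imset_card _ _) _.
by rewrite cardsX cardsT card_prod card_bool.
Qed.

Definition resources (p : 'I_m * (bool * bool)) : {set 'I_s + 'I_s} :=
  [set inl (selector1 (h p.1)); inl (selector2 (h p.1)); inr (answer (h p.1) p.2)].

(** A family [F] of active pairs is captured by the selector cells [X] and answer cells [Z] that it
    uses, and the disjoint sum of [X] and [Z] lies in the union of its resources. *)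
Lemma sparse_hall n : #|S| <= n -> sparse n -> hall_condition active resources.
Proof.
move=> Sn hs; apply/hall_conditionP => F /subsetP FA.
pose X := [set selector1 (h p.1) | p in F] :|: [set selector2 (h p.1) | p in F].
pose Z := [set answer (h p.1) p.2 | p in F].
have Zn : #|Z| <= n * 4.
  apply: (@leq_trans #|hit_cells|).
    apply/subset_leq_card/subsetP => _ /imsetP[p pF ->].
    by have := FA _ pF; rewrite inE.
  by rewrite (leq_trans card_hit_cells)// leq_mul2r Sn orbT.
apply: (@leq_trans #|captured X Z|).
  apply/subset_leq_card/subsetP => p pF; rewrite !inE.
  by apply/and3P; split; [apply/orP; left| apply/orP; right|]; apply: imset_f.
apply: leq_trans (hs _ _ Zn) _.
rewrite -(card_imset X (@inl_inj _ 'I_s)) -(card_imset Z (@inr_inj 'I_s _)).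
rewrite -cardsUI [X in _ + #|pred_of_set X|](_ : _ = finset.set0).
  rewrite cards0 addn0.
  apply/subset_leq_card/subsetP => x; rewrite inE => /orP[] /imsetP[y + ->].
    by rewrite inE => /orP[] /imsetP[p pF ->]; apply/bigcupP; exists p => //;
      rewrite !inE eqxx ?orbT.
  by move=> /imsetP[p pF ->]; apply/bigcupP; exists p => //; rewrite !inE eqxx orbT.
by apply/setP => x; rewrite !inE; apply/negP => /andP[/imsetP[y _ ->]] /imsetP[].
Qed.

(* An active pair [(u, j)] matched to a selector cell is made unreachable by the
   bit stored there; the pair matched to an answer cell is then the only
   reachable one at that cell. *)
Lemma sparse_memory n : #|S| <= n -> sparse n ->
  exists W C, forall u, Defs.eval (hash_tree u) (memory W C) = (u \in S).
Proof.
move=> Sn hs.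
have [S0|[u0 u0S]] := set_0Vmem S.
  by exists xpred0, xpred0 => u; rewrite eval_hash_tree S0 inE.
have [f [fr finj]] := hall_marriage (inl (selector1 (h u0))) (sparse_hall Sn hs).
pose W x := [exists p in active, (f p == inl x) &&
  (if selector1 (h p.1) == x then ~~ p.2.1 else ~~ p.2.2)].
pose C z := [exists p in active, (f p == inr z) && (p.1 \in S)].
exists W, C => u; rewrite eval_hash_tree.
set a := selector1 _; set b := selector2 _.
pose p := (u, (W a, W b)); rewrite -/(answer (h p.1) p.2).
have WE q x : q \in active -> f q = inl x ->
    W x = if selector1 (h q.1) == x then ~~ q.2.1 else ~~ q.2.2.
  move=> qA fq; apply/existsP/idP => [[q' /and3P[q'A /eqP fq']]|Hq].
    by rewrite (finj q q' qA q'A)// fq fq'.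
  by exists q; rewrite qA fq eqxx.
(* A selector cell matched to [p] would hold a bit contradicting the outcome actually read at [u],
   even when both selectors coincide. *)
have fp : p \in active -> f p = inr (answer (h u) (W a, W b)).
  move=> pA; have := fr _ pA; rewrite !inE -orbA => /or3P[] /eqP fpE //.
    by have := WE _ _ pA fpE; rewrite eqxx /= -/a; case: (W a).
  have := WE _ _ pA fpE; rewrite /= -/a -/b.
  by case: eqP => [->|_]; case: (W b).
apply/existsP/idP => [[q /and3P[qA /eqP fq qS]]|uS].
  (* The cell read is hit by [q.1] in [S], so [p] is active too and injectivity of [f] identifies it
     with [q]. *)
  have pA : p \in active.
    rewrite inE; apply/imsetP; exists q; first by rewrite !inE qS.
    by have := fr _ qA; rewrite fq !inE => /eqP[].
  by rewrite -[u]/(p.1) (finj p q pA qA)// fq fp.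
have pA : p \in active by rewrite inE; apply/imsetP; exists p; rewrite // !inE uS.
by exists p; rewrite pA fp // eqxx.
Qed.

End Scheme.

Lemma sparse_has_scheme m n s (h : 'I_m -> code s) :
  sparse h n -> has_scheme m n (s + s) 3.
Proof.
move=> hs.
have memP (S : small_set m n) : exists M : (s + s).-tuple bool,
    forall u, Defs.eval (hash_tree h u) M = (u \in sval S).
  by case: S => S Sn; have [W [C WC]] := sparse_memory Sn hs; exists (memory W C).
have [phi phiP] := boolp.choice memP.
by exists phi, (@QueryScheme m (s + s) 3 (hash_tree h) (fun=> isT)).
Qed.

(** * Random hash functions *)

Local Open Scope ring_scope.

Section HashWeight.

Variables (R : realType) (s : nat) (X Z : {set 'I_s}).

Definition hits (w : code s) : nat :=
  #|[set j | [&& selector1 w \in X, selector2 w \in X & answer w j \in Z]]|.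

Lemma card_captured m (h : 'I_m -> code s) :
  #|captured h X Z| = (\sum_u hits (h u))%N.
Proof.
under eq_bigr => u _ do rewrite /hits -sum1_card big_mkcond.
rewrite pair_bigA -sum1_card big_mkcond.
by apply: eq_bigr => -[u j] _; rewrite !inE.
Qed.

(** The four answers are independent, so the sum is the fourth power of a sum over one cell of
    weight [lam] in [Z] and 1 elsewhere. *)
Lemma sum_answers (lam : R) :
  \sum_(c : {ffun bool * bool -> 'I_s}) lam ^+ #|[set j | c j \in Z]| =
  (s%:R + (lam - 1) * #|Z|%:R) ^+ 4.
Proof.
pose F (j : bool * bool) (x : 'I_s) := if x \in Z then lam else 1.
transitivity (\sum_(c : {ffun bool * bool -> 'I_s}) \prod_j F j (c j)).
  apply: eq_bigr => c _; rewrite -big_mkcond /= prodr_const.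
  by congr (_ ^+ _); apply: eq_card => j; rewrite inE.
rewrite -bigA_distr_bigA /F prodr_const card_prod card_bool; congr (_ ^+ _).
rewrite (eq_bigr (fun x => 1 + (if x \in Z then lam - 1 else 0))); last first.
  by move=> x _; case: ifP; rewrite ?addr0// addrC subrK.
rewrite big_split /= sumr_const card_ord -big_mkcond /= sumr_const.
by rewrite mulr_natr.
Qed.

Lemma hitsE w : hits w =
  if (selector1 w \in X) && (selector2 w \in X) then #|[set j | answer w j \in Z]|
  else 0%N.
Proof.
rewrite /hits; case: ifP => XX.
  by apply: eq_card => j; rewrite !inE andbA XX.
by apply: eq_card0 => j; rewrite !inE andbA XX.
Qed.

(** All [s ^ 6] codes get base weight 1; only the [#|X| ^ 2] selector pairs inside [X] need the
    correction given by [sum_answers]. *)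
Lemma sum_hits (lam : R) : \sum_w lam ^+ hits w =
  s%:R ^+ 6 + #|X|%:R ^+ 2 *
    ((s%:R + (lam - 1) * #|Z|%:R) ^+ 4 - s%:R ^+ 4).
Proof.
set E := _ - _.
pose G (x y : 'I_s) : R := s%:R ^+ 4 + (if x \in X then if y \in X then E else 0 else 0).
transitivity (\sum_x \sum_y G x y).
  rewrite pair_bigA /= -(pair_bigA _ (fun p c => lam ^+ hits (p, c))) /=.
  apply: eq_bigr => -[x y] _; under eq_bigr => c _ do rewrite hitsE.
  rewrite /selector1 /selector2 /answer /= /G.
  have trivial_sum : \sum_(c : {ffun bool * bool -> 'I_s}) lam ^+ 0 = s%:R ^+ 4 + 0.
    by rewrite sumr_const card_ffun card_ord card_prod card_bool natrX addr0.
  case: ifP => //= _; case: ifP => //= _.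
  by rewrite sum_answers /E [RHS]addrC subrK.
rewrite (eq_bigr (fun x => s%:R ^+ 5 + (if x \in X then #|X|%:R * E else 0))).
  rewrite big_split /= -big_mkcond /= !sumr_const card_ord.
  by rewrite -(mulr_natl (_ ^+ _)) -(mulr_natl (_ * E)) -exprS mulrA.
move=> x _; rewrite big_split /= sumr_const card_ord -(mulr_natl (_ ^+ _)) -exprS.
congr (_ + _); case: ifP => _; last by rewrite big1.
by rewrite -big_mkcond /= sumr_const mulr_natl.
Qed.

End HashWeight.

Lemma sum_captured (R : realType) (m s : nat) (X Z : {set 'I_s}) (lam : R) :
  \sum_(h : {ffun 'I_m -> code s}) lam ^+ #|captured h X Z| =
  (\sum_w lam ^+ hits X Z w) ^+ m.
Proof.
transitivity (\prod_(u : 'I_m) \sum_w lam ^+ hits X Z w).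
  rewrite bigA_distr_bigA; apply: eq_bigr => h _.
  by rewrite card_captured -prodrXr.
by rewrite prodr_const card_ord.
Qed.

Lemma card_code s : #|{: code s}| = (s ^ 6)%N.
Proof.
rewrite 2!card_prod card_ffun card_prod card_bool !card_ord.
by rewrite !expnS expn0 muln1 !mulnA.
Qed.

Definition overfull m s (X Z : {set 'I_s}) : {set {ffun 'I_m -> code s}} :=
  [set h : {ffun 'I_m -> code s} | (#|X| + #|Z| < #|captured h X Z|)%N].

(* Markov's inequality for [lam ^+ #|captured h X Z|], where [lam] is chosen so
   that each answer cell in [Z] accounts for a factor [1 + tau]. *)
Lemma card_overfull (R : realType) (m s : nat) (X Z : {set 'I_s}) (tau : R) :
  0 < tau -> (0 < #|Z|)%N -> (0 < s)%N ->
  #|overfull m X Z|%:R <= #|{ffun 'I_m -> code s}|%:R *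
    ((#|Z|%:R / (tau * s%:R)) ^+ (#|X| + #|Z|) *
     expR (m%:R * #|X|%:R ^+ 2 / s%:R ^+ 2 * ((1 + tau) ^+ 4 - 1))).
Proof.
move=> tau0 Z0 s0.
have sR : 0 < s%:R :> R by rewrite ltr0n.
have ZR : 0 < #|Z|%:R :> R by rewrite ltr0n.
(* This choice turns [s + q * #|Z|] into [s * (1 + tau)]. *)
pose q : R := tau * s%:R / #|Z|%:R.
have q0 : 0 < q by rewrite divr_gt0// mulr_gt0.
pose lam : R := 1 + q.
have lam1 : 1 <= lam by rewrite lerDl ltW.
have sumE : \sum_(h : {ffun 'I_m -> code s}) lam ^+ #|captured h X Z| <=
    #|{ffun 'I_m -> code s}|%:R *
    expR (m%:R * #|X|%:R ^+ 2 / s%:R ^+ 2 * ((1 + tau) ^+ 4 - 1)).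
  rewrite sum_captured sum_hits card_ffun card_code card_ord !natrX.
  rewrite -2!(mulrA m%:R) expRM_natl -exprMn lerXn2r ?nnegrE//.
    by rewrite -sum_hits; apply: sumr_ge0 => w _; rewrite exprn_ge0// (le_trans ler01).
  rewrite /lam [1 + q]addrC addrK /q divfK ?gt_eqF//.
  apply: le_trans (ler_wpM2l _ (expR_ge1Dx _)); last exact: exprn_ge0.
  by rewrite le_eqVlt; apply/orP; left; apply/eqP; field; rewrite gt_eqF.
have bad : #|overfull m X Z|%:R * q ^+ (#|X| + #|Z|) <=
    \sum_(h : {ffun 'I_m -> code s}) lam ^+ #|captured h X Z|.
  rewrite mulr_natl -sumr_const.
  rewrite [leRHS](bigID (mem (overfull m X Z)))/= -[leLHS]addr0 lerD//.
    apply: ler_sum => h; rewrite inE => hh.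
    apply: (@le_trans _ _ (lam ^+ (#|X| + #|Z|))).
      by rewrite lerXn2r ?nnegrE ?ltW// /lam ?ltrDr// addr_gt0.
    by rewrite ler_weXn2l// ltnW.
  by apply: sumr_ge0 => h _; rewrite exprn_ge0// (le_trans ler01).
have qV : (#|Z|%:R / (tau * s%:R)) ^+ (#|X| + #|Z|) = (q ^+ (#|X| + #|Z|))^-1.
  by rewrite -exprVn /q invf_div.
rewrite qV mulrCA mulrC ler_pdivlMr ?exprn_gt0//.
exact: le_trans bad sumE.
Qed.

(** * The union bound *)

Section ExponentialSums.

Variable R : realType.
Implicit Types x : R.

Lemma sum_exp_coeff_le x N : 0 <= x ->
  \sum_(k < N) x ^+ k.+1 / (k.+1)`!%:R <= expR x.
Proof.
move=> x0; apply: (@le_trans _ _ (series (exp_coeff x) N.+1)).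
  rewrite /series /= big_mkord big_ord_recl /=.
  rewrite lerDr /exp_coeff /=; exact: exp_coeff_ge0.
apply: nondecreasing_cvgn_le; last exact: is_cvg_series_exp_coeff.
apply/nondecreasing_seqP => n; rewrite /series /= big_nat_recr//= lerDl.
exact: exp_coeff_ge0.
Qed.

Lemma exp_coeff_le x k : 0 <= x -> x ^+ k.+1 / (k.+1)`!%:R <= expR x.
Proof. by move=> x0; apply: le_trans (expR_ge1Dxn k x0); rewrite lerDr. Qed.

(** The crude Stirling bound [k ^ k / k! <= e ^ k]: the left side is one term of the series of
    [expR k]. *)
Lemma natpow_div_fact_le x k : 0 <= x ->
  (k.+1%:R * x) ^+ k.+1 / (k.+1)`!%:R <= (expR 1 * x) ^+ k.+1.
Proof.
move=> x0; rewrite exprMn mulrAC exprMn ler_wpM2r ?exprn_ge0//.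
by apply: le_trans (exp_coeff_le k _) _ => //; rewrite -expRM_natl mulr1.
Qed.

Lemma sum_quarter_pow N : \sum_(k < N) (4^-1 : R) ^+ k.+1 <= 3^-1.
Proof.
have -> : \sum_(k < N) (4^-1 : R) ^+ k.+1 = 3^-1 * (1 - 4^-1 ^+ N).
  elim: N => [|N IH]; first by rewrite big_ord0 expr0 subrr mulr0.
  by rewrite big_ord_recr /= IH exprS; field.
by rewrite ler_piMr// gerBl exprn_ge0.
Qed.

Let e : R := expR 1.
(** [T] and [delta] make the geometric ratios [e * (e / T)] and [e * (e * delta) * e] below equal to
    1/4. *)
Let T := 4 * e ^+ 2.
Let delta := (4 * e ^+ 3)^-1.
Let term (x : R) v z := (e * x) ^+ v / v`!%:R * (x ^+ z / z`!%:R).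

Let e_gt0 : 0 < e. Proof. exact: expR_gt0. Qed.
Let e_ge1 : 1 <= e. Proof. by rewrite /e; apply: le_trans (expR_ge1Dx _); lra. Qed.
Let T_gt0 : 0 < T. Proof. by rewrite mulr_gt0// exprn_gt0. Qed.
Let delta_gt0 : 0 < delta. Proof. by rewrite invr_gt0 mulr_gt0// exprn_gt0. Qed.

Let exp_le_e_pow (x : R) k : x <= 1 -> expR (k%:R * x) <= e ^+ k.
Proof. by move=> x1; rewrite expRM_natl lerXn2r ?nnegrE ?expR_ge0// ler_expR. Qed.

(** The sum over [i] is part of an exponential series, at most [e ^+ k.+1] since [e <= T]; the
    Stirling bound on the other factor leaves a geometric series in [k]. *)
Let sum_term_few N M :
  \sum_(i < N) \sum_(k < M) term (k.+1%:R / T) i.+1 k.+1 <= 3^-1.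
Proof.
rewrite exchange_big /=; apply: le_trans (sum_quarter_pow M).
apply: ler_sum => k _; rewrite -mulr_suml.
have kT : 0 <= k.+1%:R / T by rewrite divr_ge0// ltW.
rewrite (_ : 4^-1 = e * (e * T^-1)); last first.
  by rewrite /T; field; rewrite gt_eqF.
rewrite [leRHS]exprMn ler_pM//.
- by apply: sumr_ge0 => i _; rewrite divr_ge0 ?exprn_ge0// mulr_ge0// ltW.
- by rewrite divr_ge0 ?exprn_ge0.
- apply: le_trans (sum_exp_coeff_le _ _) _; first by rewrite mulr_ge0// ltW.
  rewrite mulrCA exp_le_e_pow// ler_pdivrMr// mul1r.
  have : e <= e ^+ 2 by rewrite ler_eXnr.
  by have := e_gt0; rewrite /T; lra.
- by apply: natpow_div_fact_le; rewrite invr_ge0 ltW.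
Qed.

(** Here the exponential series runs over [k] and the geometric one over [i]. *)
Let sum_term_many N M :
  \sum_(i < N) \sum_(k < M) term (i.+1%:R * delta) i.+1 k.+1 <= 3^-1.
Proof.
apply: le_trans (sum_quarter_pow N).
apply: ler_sum => i _; rewrite -mulr_sumr.
have id0 : 0 <= i.+1%:R * delta by rewrite mulr_ge0// ltW.
rewrite (_ : 4^-1 = (e * (e * delta)) * e); last first.
  by rewrite /delta; field; rewrite gt_eqF.
rewrite [leRHS]exprMn ler_pM//.
- by rewrite divr_ge0 ?exprn_ge0// mulr_ge0// ltW.
- by apply: sumr_ge0 => k _; rewrite divr_ge0 ?exprn_ge0.
- rewrite mulrCA; apply: natpow_div_fact_le.
  by rewrite mulr_ge0// ltW.
- apply: le_trans (sum_exp_coeff_le _ _) _ => //.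
  rewrite exp_le_e_pow// /delta invf_le1 ?mulr_gt0 ?exprn_gt0//.
  have : 1 <= e ^+ 3 by rewrite exprn_ege1.
  lra.
Qed.

(* Few selector cells ([r i <= T^-1]) and many selector cells need different
   tilting parameters, hence the two alternatives for [r]. *)
Lemma first_moment_sum N n (r : nat -> R) :
  (forall i, 0 <= r i) ->
  (forall i, r i <= T^-1 \/ r i <= i.+1%:R * delta / (n * 4)%:R) ->
  \sum_(i < N) \sum_(k < n * 4)
    expR i.+1%:R * ((k.+1%:R * r i) ^+ i.+1 / (i.+1)`!%:R *
                    ((k.+1%:R * r i) ^+ k.+1 / (k.+1)`!%:R)) <= 2 / 3.
Proof.
move=> r0 rle.
have term_ge0 x v z : 0 <= x -> 0 <= term x v z.
  by move=> x0; rewrite mulr_ge0// divr_ge0// exprn_ge0// mulr_ge0// ltW.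
have term_le x y v z : 0 <= x -> x <= y -> term x v z <= term y v z.
  move=> x0 xy; have y0 := le_trans x0 xy; have ex := mulr_ge0 (ltW e_gt0) x0.
  rewrite ler_pM ?divr_ge0 ?exprn_ge0// ler_wpM2r ?invr_ge0// lerXn2r ?nnegrE//.
    by rewrite mulr_ge0// ltW.
  by rewrite ler_wpM2l// ltW.
apply: (@le_trans _ _ (\sum_(i < N) \sum_(k < n * 4)
    (term (k.+1%:R / T) i.+1 k.+1 + term (i.+1%:R * delta) i.+1 k.+1))).
  apply: ler_sum => i _; apply: ler_sum => k _.
  have -> : expR i.+1%:R = e ^+ i.+1 by rewrite -[i.+1%:R]mulr1 expRM_natl.
  rewrite (mulrA (e ^+ _)) (mulrA (e ^+ _)) -exprMn.
  rewrite -[leLHS]/(term (k.+1%:R * r i) i.+1 k.+1).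
  have kT : 0 <= k.+1%:R / T by rewrite divr_ge0// ltW.
  have id0 : 0 <= i.+1%:R * delta by rewrite mulr_ge0// ltW.
  have kr0 : 0 <= k.+1%:R * r i by rewrite mulr_ge0.
  case: (rle i) => ri.
    by rewrite -[leLHS]addr0 lerD ?term_ge0// term_le// ler_wpM2l.
  rewrite -[leLHS]add0r lerD ?term_ge0// term_le//.
  apply: le_trans (ler_wpM2l _ ri) _ => //.
  rewrite mulrCA ler_piMr// ler_pdivrMr ?mul1r ?ler_nat//.
  by rewrite ltr0n (leq_ltn_trans _ (ltn_ord k)).
under eq_bigr do rewrite big_split /=.
rewrite big_split /= (_ : 2 / 3 = 3^-1 + 3^-1); last by field.
exact: lerD (sum_term_few _ _) (sum_term_many _ _).
Qed.

End ExponentialSums.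

Lemma bin_mul_exp_le (R : realType) s v (x : R) : (0 < s)%N -> 0 <= x ->
  'C(s, v)%:R * (x / s%:R) ^+ v <= x ^+ v / v`!%:R.
Proof.
move=> s0 x0; have sR : 0 < s%:R :> R by rewrite ltr0n.
rewrite ler_pdivlMr ?ltr0n ?fact_gt0// mulrAC -natrM bin_ffact.
rewrite expr_div_n mulrCA ler_piMr ?exprn_ge0// ler_pdivrMr ?exprn_gt0// mul1r.
rewrite -natrX ler_nat ffact_prod -[in leqRHS](card_ord v) -prod_nat_const.
by apply: leq_prod => i _; apply: leq_subr.
Qed.

Lemma sum_over_card (R : realType) (T : finType) N (F : nat -> R) :
  \sum_(A : {set T} | (0 < #|A| <= N)%N) F #|A| =
  \sum_(k < N) 'C(#|T|, k.+1)%:R * F k.+1.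
Proof.
transitivity (\sum_(A : {set T}) \sum_(k < N) if #|A| == k.+1 then F k.+1 else 0).
  rewrite big_mkcond; apply: eq_bigr => A _; rewrite -big_mkcond /=.
  case: #|A| => [|a]; first by rewrite big_pred0.
  rewrite (eq_bigl (fun k : 'I_N => (k : nat) == a)); last first.
    by move=> k; rewrite eqSS eq_sym.
  by rewrite (big_ord1_eq _ (fun k => F k.+1)).
rewrite exchange_big; apply: eq_bigr => k _ /=.
rewrite -big_mkcond -card_draws mulr_natl -sumr_const /=.
by apply: eq_bigl => A; rewrite inE.
Qed.

Lemma card_bigcup_le (I J : finType) (P : pred I) (A : I -> {set J}) :
  (#|\bigcup_(i | P i) A i| <= \sum_(i | P i) #|A i|)%N.
Proof.
elim/big_rec2: _ => [|i n B _ le]; first by rewrite cards0.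
by apply: leq_trans (leq_card_setU _ _) _; rewrite leq_add2l.
Qed.

(** A convex function vanishing at 0 has nondecreasing slope from 0. *)
Lemma pow4_sub1_convex (R : realType) (t T : R) : 0 <= t -> t <= T ->
  T * ((1 + t) ^+ 4 - 1) <= t * ((1 + T) ^+ 4 - 1).
Proof.
move=> t0 tT; have T0 := le_trans t0 tT.
have E (x : R) : (1 + x) ^+ 4 - 1 = x * (4 + 6 * x + 4 * x ^+ 2 + x ^+ 3) by ring.
rewrite !E mulrCA ler_wpM2l// ler_wpM2l//.
have := lerXn2r 2 t0 T0 tT; have := lerXn2r 3 t0 T0 tT; lra.
Qed.

(** Without a sparse function, the sets [overfull m X Z] would cover everything. The condition on
    [tau] caps the exponential factor of [card_overfull] at [expR v], and counting [X] and [Z] by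
    binomials cancels the powers of [s]. *)
Lemma exists_sparse_of_sum (R : realType) m n s (tau : nat -> R) :
  (0 < s)%N -> (forall v, 0 < tau v) ->
  (forall v, (0 < v)%N ->
    m%:R * v%:R ^+ 2 / s%:R ^+ 2 * ((1 + tau v) ^+ 4 - 1) <= v%:R) ->
  \sum_(i < s) \sum_(k < n * 4)
    expR i.+1%:R * ((k.+1%:R / tau i.+1) ^+ i.+1 / (i.+1)`!%:R *
                    ((k.+1%:R / tau i.+1) ^+ k.+1 / (k.+1)`!%:R)) < 1 ->
  exists h : 'I_m -> code s, sparse h n.
Proof.
move=> s0 tau0 tauP sum_lt1; apply: contrapT => /forallNP nsparse.
have sR : 0 < s%:R :> R by rewrite ltr0n.
pose N := #|{ffun 'I_m -> code s}|.
have N0 : (0 < N)%N.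
  by apply/card_gt0P; exists [ffun=> ((Ordinal s0, Ordinal s0), [ffun=> Ordinal s0])].
pose P (p : {set 'I_s} * {set 'I_s}) := (0 < #|p.1| <= s)%N && (0 < #|p.2| <= n * 4)%N.
have cover : (N <= \sum_(p | P p) #|overfull m p.1 p.2|)%N.
  apply: leq_trans (card_bigcup_le _ _); rewrite /N -cardsT.
  apply/subset_leq_card/subsetP => h _.
  have /existsNP[X /existsNP[Z /not_implyP[Zn /negP]]] := nsparse h.
  rewrite -ltnNge => XZ; apply/bigcupP; exists (X, Z); last by rewrite inE.
  (* An overfull pair captures something, so [X] and [Z] are nonempty, as [card_overfull] requires
     of [Z]. *)
  have /card_gt0P[p] := leq_ltn_trans (leq0n _) XZ.
  rewrite inE => /and3P[pX _ pZ]; rewrite /P /= Zn (leq_trans (max_card _)) ?card_ord//.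
  by rewrite !andbT; apply/andP; split; apply/card_gt0P; [exists (selector1 (h p.1))|
    exists (answer (h p.1) p.2)].
pose G v z : R := (z%:R / (tau v * s%:R)) ^+ (v + z) * expR v%:R.
have leG p : P p -> #|overfull m p.1 p.2|%:R <= N%:R * G #|p.1| #|p.2|.
  move=> /andP[/andP[X0 _] /andP[Z0 _]].
  apply: le_trans (card_overfull m p.1 (tau0 #|p.1|) Z0 s0) _.
  rewrite ler_wpM2l// ler_wpM2l ?exprn_ge0 ?divr_ge0 ?mulr_ge0 ?ler0n ?(ltW (tau0 _))//.
  by rewrite ler_expR tauP.
have : N%:R <= N%:R * (\sum_(p | P p) G #|p.1| #|p.2|).
  rewrite mulr_sumr; apply: (@le_trans _ _ (\sum_(p | P p) #|overfull m p.1 p.2|%:R)).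
    by rewrite -natr_sum ler_nat.
  exact: ler_sum.
apply/negP; rewrite -ltNge gtr_pMr ?ltr0n//; apply: le_lt_trans sum_lt1.
rewrite -(pair_big (fun X : {set 'I_s} => 0 < #|X| <= s)%N
  (fun Z : {set 'I_s} => 0 < #|Z| <= n * 4)%N (fun X Z => G #|X| #|Z|)) /=.
under eq_bigr do rewrite sum_over_card.
rewrite (sum_over_card _ s (fun v => \sum_(k < n * 4) 'C(#|'I_s|, k.+1)%:R * G v k.+1)).
rewrite card_ord; apply: ler_sum => i _; rewrite mulr_sumr; apply: ler_sum => k _.
have kt0 : 0 <= k.+1%:R / tau i.+1 by rewrite divr_ge0// ltW.
rewrite /G invfM (mulrA k.+1%:R) exprD; set x := _ / tau _ in kt0 *.
have AC (a b c d f : R) : a * (b * (c * d * f)) = f * (a * c * (b * d)) by ring.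
rewrite AC ler_wpM2l ?expR_ge0//; apply: ler_pM; rewrite ?bin_mul_exp_le//.
- by rewrite mulr_ge0// exprn_ge0// divr_ge0.
- by rewrite mulr_ge0// exprn_ge0// divr_ge0.
Qed.

Lemma exists_sparse (R : realType) : exists2 K : R, 1 <= K &
  forall m n s, (0 < n)%N -> (0 < s)%N -> K * (m%:R * n%:R) <= s%:R ^+ 2 ->
    exists h : 'I_m -> code s, sparse h n.
Proof.
pose e : R := expR 1; have e0 : 0 < e by exact: expR_gt0.
have e1 : 1 <= e by rewrite /e; apply: le_trans (expR_ge1Dx _); lra.
pose T := 4 * e ^+ 2; have T0 : 0 < T by rewrite mulr_gt0// exprn_gt0.
pose delta := (4 * e ^+ 3)^-1.
have delta0 : 0 < delta by rewrite invr_gt0 mulr_gt0// exprn_gt0.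
have delta1 : delta <= 1.
  rewrite invf_le1 ?mulr_gt0 ?exprn_gt0//.
  have : 1 <= e ^+ 3 by rewrite exprn_ege1.
  lra.
pose D := (1 + T) ^+ 4 - 1.
have DT : T <= D.
  have -> : D = T + T * (3 + 6 * T + 4 * T ^+ 2 + T ^+ 3) by rewrite /D; ring.
  rewrite lerDl mulr_ge0// ?ltW// !addr_gt0 ?mulr_gt0 ?exprn_gt0//.
have D0 := lt_le_trans T0 DT.
pose K := 4 * D / (T * delta).
have K0 : 0 < K by rewrite divr_gt0 ?mulr_gt0// !mulr_gt0.
exists K.
  rewrite ler_pdivlMr ?mulr_gt0// mul1r.
  by apply: le_trans (ler_piMr (ltW T0) delta1) _; lra.
move=> m n s n0 s0 Kmn.
have nR : 0 < n%:R :> R by rewrite ltr0n.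
have sR : 0 < s%:R :> R by rewrite ltr0n.
(* [bound v] is the tilt up to which convexity keeps the exponent in
   [card_overfull] at most [v]; [K] is such that [(bound v)^-1 = v delta / (4 n)]. *)
pose bound v := T * (K * n%:R) / (v%:R * D).
(* Division by zero makes [bound 0] vanish, so [T] keeps [tau 0] positive. *)
pose tau v := if v is 0 then T else Num.min T (bound v).
have bound0 v : 0 < bound v.+1.
  by apply: divr_gt0; apply: mulr_gt0 => //; apply: mulr_gt0.
have tau0 v : 0 < tau v by case: v => // v; rewrite /tau lt_min T0 bound0.
apply: (exists_sparse_of_sum s0 tau0).
  move=> [//|v] _.
  have tauT : tau v.+1 <= T by rewrite /tau ge_min lexx.
  have tauB : tau v.+1 <= bound v.+1 by rewrite /tau ge_min lexx orbT.
  have conv := pow4_sub1_convex (ltW (tau0 v.+1)) tauT.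
  (* By convexity the left side is at most [tau * D / T], and [bound] cancels [D / T]. *)
  have pow_le : (1 + tau v.+1) ^+ 4 - 1 <= K * n%:R / v.+1%:R.
    rewrite -(ler_pM2l T0); apply: le_trans conv _; rewrite -/D.
    apply: le_trans (ler_wpM2r (ltW D0) tauB) _.
    rewrite le_eqVlt; apply/orP; left; apply/eqP; rewrite /bound; field.
    by rewrite nat1r pnatr_eq0 /= gt_eqF.
  rewrite mulrAC ler_pdivrMr ?exprn_gt0//.
  apply: (@le_trans _ _ (m%:R * v.+1%:R ^+ 2 * (K * n%:R / v.+1%:R))).
    by rewrite ler_wpM2l// mulr_ge0// exprn_ge0.
  have -> : m%:R * v.+1%:R ^+ 2 * (K * n%:R / v.+1%:R) =
      v.+1%:R * (K * (m%:R * n%:R)) :> R.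
    by field; rewrite nat1r pnatr_eq0.
  by rewrite ler_wpM2l.
apply: le_lt_trans (first_moment_sum s (n := n) (r := fun i => (tau i.+1)^-1) _ _) _.
- by move=> i; rewrite invr_ge0 ltW.
- move=> i; rewrite /tau minElt; case: ifP => _; [by left|right].
  rewrite le_eqVlt; apply/orP; left; apply/eqP.
  rewrite /bound /K -/e -/delta natrM; field.
  by rewrite !gt_eqF// ltr0n.
- lra.
Qed.

(** * Passing to the minimum space *)

Lemma has_scheme_min m n t s : has_scheme m n s t ->
  exists2 s', min_space m n t s' & (s' <= s)%N.
Proof.
move=> hs; have ex : exists s0, `[< has_scheme m n s0 t >] by exists s; apply/asboolP.
case: (ex_minnP ex) => s' /asboolP hs' min.
by exists s'; [split=> // k hk|]; apply: min; apply/asboolP.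
Qed.

Lemma lg_ge1 (R : realType) (x : R) : 2 <= x -> 1 <= lg x.
Proof.
move=> x2; rewrite /lg ler_pdivlMr ?mul1r ?ln_gt0 ?ltr1n// ler_ln// posrE//.
exact: lt_le_trans x2.
Qed.

Theorem theorem3 (R : realType) :
  exists C : R, 0 < C /\
  exists m0 : nat, forall m n : nat,
    (m0 <= m)%N -> (0 < n)%N -> (n <= m)%N ->
    exists s : nat, min_space m n 3 s /\
      s%:R <= C * Num.sqrt (m%:R * n%:R * lg (2 * m%:R / n%:R)).
Proof.
have [K K1 KP] := exists_sparse R.
have K0 : 0 < K by exact: lt_le_trans K1.
(* One factor 2 pays for the two tables, the other for rounding [r >= 1] up to [s <= 2 * r]. *)
exists (4 * Num.sqrt K); split; first by rewrite mulr_gt0 ?sqrtr_gt0.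
exists 0%N => m n _ n0 nm.
have m0 := leq_trans n0 nm.
have nR : 1 <= n%:R :> R by rewrite ler1n.
have nmR : n%:R <= m%:R :> R by rewrite ler_nat.
pose r : R := Num.sqrt (K * (m%:R * n%:R)).
have r1 : 1 <= r by rewrite -(sqrtr1 R) ler_wsqrtr// mulr_ege1// mulr_ege1// (le_trans nR).
pose s := (Num.trunc r).+1.
have rs : r < s%:R by exact: truncnS_gt.
have sr : s%:R <= 2 * r.
  have : (Num.trunc r)%:R <= r by rewrite truncn_le// (le_trans ler01).
  by rewrite /s -natr1; lra.
have [|h hsparse] := KP m n s n0 isT.
  have -> : K * (m%:R * n%:R) = r ^+ 2 by rewrite sqr_sqrtr// !mulr_ge0// ltW.
  by rewrite lerXn2r ?nnegrE ?ltW// (lt_le_trans ltr01).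
have [s' smin s's] := has_scheme_min (sparse_has_scheme hsparse).
exists s'; split=> //; apply: (@le_trans _ _ (4 * r)).
  apply: (@le_trans _ _ (s + s)%:R); first by rewrite ler_nat.
  by rewrite natrD; lra.
(* As [n <= m], the logarithm is at least 1 and only enlarges the bound. *)
rewrite -(mulrA 4) ler_pM2l// -(sqrtrM _ (ltW K0)) ler_wsqrtr// (ler_pM2l K0).
rewrite ler_peMr ?mulr_ge0// lg_ge1// ler_pdivlMr; last by lra.
by rewrite ler_wpM2l.
Qed.
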